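(* The Sparsemax mapping and the $\alpha$-Entmax mapping $\mathbb R^C\to\Delta^C$ are weakly order preserving but not strictly order preserving.
   Context: $C$ is the number of classes and $\Delta^C=\{p\in\mathbb R^C: p_i\ge 0,\ \sum_i p_i=1\}$. The Sparsemax mapping is $\hat p_i(s)=\max\{s_i-\tau(s),0\}$, and the $\alpha$-Entmax mapping (with $\alpha>1$) is $\hat p_i(s)=\big((\alpha-1)(s_i-\tau(s))_+\big)^{1/(\alpha-1)}$, where $(t)_+=\max\{t,0\}$ and in each case $\tau(s)\in\mathbb R$ is the threshold chosen so that $\sum_{i=1}^C\hat p_i(s)=1$. A mapping $\hat p:\mathbb R^C\to\Delta^C$ is strictly order preserving (SOP) if for any $i\ne j$, $s_i>s_j\iff\hat p_i(s)>\hat p_j(s)$ holds for all $s\in\mathbb R^C$. It is weakly order preserving (WOP) if for any $i\neq j$, $s_i>s_j\Rightarrow\hat p_i(s)\ge\hat p_j(s)$ holds for all $s$, and moreover there exist $s$ and $i\ne j$ with $s_i>s_j$ and yet $\hat p_i(s)=\hat p_j(s)$.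
   Formalization: The number of classes is assumed to be C ≥ 3: for C = 2 equal outputs must both be 1/2 > 0, forcing equal scores, so both mappings are strictly order preserving; for C = 1 there are no distinct indices, and for C = 0 the simplex is empty. *)

(* Defs.v *)
From HB Require Import structures.
From mathcomp Require Import all_boot all_order all_algebra.
From mathcomp Require Import boolp classical_sets reals exp.
Set Implicit Arguments.
Unset Strict Implicit.
Unset Printing Implicit Defensive.
Import Order.TTheory GRing.Theory Num.Theory.
Local Open Scope classical_set_scope.
Local Open Scope ring_scope.

Definition simplex (R : realType) (C : nat) : set 'rV[R]_C :=
  [set p | (forall i, 0 <= p 0 i) /\ \sum_i p 0 i = 1].

Definition strictly_order_preserving (R : realType) (C : nat)
    (p : 'rV[R]_C -> 'rV[R]_C) : Prop :=
  forall i j : 'I_C, i != j -> forall s : 'rV[R]_C,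
    s 0 i > s 0 j <-> p s 0 i > p s 0 j.

Definition weakly_order_preserving (R : realType) (C : nat)
    (p : 'rV[R]_C -> 'rV[R]_C) : Prop :=
  (forall i j : 'I_C, i != j -> forall s : 'rV[R]_C,
     s 0 i > s 0 j -> p s 0 i >= p s 0 j) /\
  (exists (s : 'rV[R]_C) (i j : 'I_C),
     [/\ i != j, s 0 i > s 0 j & p s 0 i = p s 0 j]).

(* A t for which the coordinates of f t sum to 1, or 0 if there is none;
   membership of f (threshold f) in the simplex rules out the latter. *)
Definition threshold (R : realType) (C : nat) (f : R -> 'rV[R]_C) : R :=
  xget 0 [set t | \sum_i f t 0 i = 1].

Definition sparsemax_at (R : realType) (C : nat) (s : 'rV[R]_C) (t : R) :
    'rV[R]_C :=
  \row_i Num.max (s 0 i - t) 0.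

Definition sparsemax (R : realType) (C : nat) (s : 'rV[R]_C) : 'rV[R]_C :=
  sparsemax_at s (threshold (sparsemax_at s)).

(* Since alpha > 1, the exponent is nonzero, so 0 `^ (alpha - 1)^-1 = 0. *)
Definition entmax_at (R : realType) (C : nat) (alpha : R) (s : 'rV[R]_C)
    (t : R) : 'rV[R]_C :=
  \row_i ((alpha - 1) * Num.max (s 0 i - t) 0) `^ (alpha - 1)^-1.

Definition entmax (R : realType) (C : nat) (alpha : R) (s : 'rV[R]_C) :
    'rV[R]_C :=
  entmax_at alpha s (threshold (entmax_at alpha s)).

(* Main.v *)
Require Import Defs.
From HB Require Import structures.
From mathcomp Require Import all_boot all_order all_algebra.
From mathcomp Require Import boolp classical_sets reals exp.
From mathcomp Require Import topology normedtype derive.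
From mathcomp Require Import lra.
Set Implicit Arguments.
Unset Strict Implicit.
Unset Printing Implicit Defensive.
Import Order.TTheory GRing.Theory Num.Theory.
Import numFieldNormedType.Exports.
Local Open Scope classical_set_scope.
Local Open Scope ring_scope.

(* Both mappings have the form p_i(s) = g (s_i - t), where g is continuous and
   nondecreasing, vanishes on the nonpositive reals, and exceeds 1 exactly
   beyond the point c where g c = 1. The intermediate value theorem gives the
   threshold t, and monotonicity of g gives the weak order preservation. For
   s = (c + 1, 1, 0, ..., 0), a threshold t < 1 would make the first coordinate
   exceed 1, so t >= 1 and the coordinates 1 and 0 are both sent to 0. *)

Lemma le_pos_part (R : realType) (x y : R) :
  x <= y -> Num.max x 0 <= Num.max y 0.
Proof. by move=> xy; rewrite ge_max !le_max xy lexx orbT. Qed.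

(** Near a negative point the function is constantly 0, and near a positive point it agrees with the
    differentiable power function. At 0 the one-sided limits are compared: the left one is constant,
    the right one tends to 0 because [r] is positive. *)
Lemma continuous_powR_pos_part (R : realType) (r : R) : 0 < r ->
  continuous (fun x : R => Num.max x 0 `^ r).
Proof.
move=> r0 x.
have [x0|x0|->] := ltgtP x 0.
- rewrite /continuous_at max_r ?powR0 ?gt_eqF ?(ltW x0)//.
  apply: cvg_near_cst; near=> y.
  by rewrite max_r ?powR0 ?gt_eqF// ltW//; near: y; exact: lt_nbhsl.
- rewrite /continuous_at max_l ?(ltW x0)//.
  apply: (@cvg_trans _ (y `^ r @[y --> x])).
    apply: near_eq_cvg; near=> y.
    by rewrite max_l// ltW//; near: y; exact: lt_nbhsr.
  apply: (@differentiable_continuous R R R x (@powR R ^~ r)).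
  apply/derivable1_diffP.
  by apply: derivable_powR; rewrite in_itv/= x0.
- apply/left_right_continuousP; split; rewrite max_r ?powR0 ?gt_eqF//.
    apply: cvg_near_cst; near=> y.
    by rewrite max_r ?powR0 ?gt_eqF// ltW.
  apply: cvg_trans (powR_cvg0 r0).
  by apply: near_eq_cvg; near=> y; rewrite max_l// ltW.
Unshelve. all: by end_near. Qed.

Lemma weakly_order_preserving_not_strictly (R : realType) (C : nat)
    (p : 'rV[R]_C -> 'rV[R]_C) :
  weakly_order_preserving p -> ~ strictly_order_preserving p.
Proof.
move=> [_ [s [i [j [ij sij pij]]]]] /(_ i j ij s) [/(_ sij)].
by rewrite pij ltxx.
Qed.

Section threshold_mapping.
Variables (R : realType) (C : nat) (g : R -> R) (c : R).
Hypothesis C3 : (3 <= C)%N.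
Hypothesis g_cont : continuous g.
Hypothesis g_homo : {homo g : x y / x <= y}.
Hypothesis g_le0 : forall x : R, x <= 0 -> g x = 0.
Hypothesis gc : g c = 1.
Hypothesis g_gt1 : forall x, c < x -> 1 < g x.

(** For suitable [g], [map] is convertible to [sparsemax] and to [entmax alpha], so the results of
    this section apply to both directly. *)
Let at_ (s : 'rV[R]_C) (t : R) : 'rV[R]_C := \row_i g (s 0 i - t).
Let map (s : 'rV[R]_C) : 'rV[R]_C := at_ s (threshold (at_ s)).

Let g_ge0 x : 0 <= g x.
Proof.
have [x0|/ltW x0] := leP x 0; first by rewrite g_le0.
by rewrite -(g_le0 (lexx 0)) g_homo.
Qed.

(** Used twice: to bound the sum below at the left end of the interval for the threshold, and to
    bound the threshold itself in the example of a tie. *)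
Let sum_at_ge (s : 'rV[R]_C) t i : g (s 0 i - t) <= \sum_j at_ s t 0 j.
Proof.
by rewrite (bigD1 i)//= mxE lerDl sumr_ge0// => j _; rewrite mxE.
Qed.

Lemma threshold_exists (s : 'rV[R]_C) : exists t, \sum_i at_ s t 0 i = 1.
Proof.
pose i0 : 'I_C := Ordinal (leq_trans (isT : 0 < 3)%N C3).
have [m _ sm] :=
  @Order.TotalTheory.arg_maxP _ _ _ i0 predT (fun i => s 0 i) isT.
(* A negative [c] would give [g c = 0]; the sign of [c] puts the endpoints [s 0 m - c] and [s 0 m]
   in order. *)
have c_ge0 : 0 <= c.
  by rewrite leNgt; apply/negP => /ltW/g_le0/eqP; rewrite gc oner_eq0.
have [|||t _ tE] := @IVT R (fun t => \sum_i at_ s t 0 i) (s 0 m - c) (s 0 m) 1.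
- by rewrite gerBl.
- apply: continuous_subspaceT.
  apply: continuous_big; first exact: add_continuous.
  move=> i _.
  rewrite (_ : (fun t => _) = g \o (fun t => s 0 i - t)); last first.
    by apply/funext => t; rewrite mxE.
  move=> t; apply: continuous_comp; last exact: g_cont.
  by apply: cvgB; [exact: cvg_cst|exact: cvg_id].
(* At [s 0 m], the largest score, every summand vanishes; at [s 0 m - c] the summand of index [m]
   alone is [g c = 1]. *)
- rewrite [X in Num.min _ X]big1 ?[X in Num.max _ X]big1; last 2 first.
  + by move=> i _; rewrite mxE g_le0// subr_le0; exact: sm.
  + by move=> i _; rewrite mxE g_le0// subr_le0; exact: sm.
  rewrite ge_min ler01 orbT le_max/=.
  by have := sum_at_ge s (s 0 m - c) m; rewrite subKr gc => ->.
- by exists t.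
Qed.

Let sum_map s : \sum_i map s 0 i = 1.
Proof.
(* The default value of [xget] is excluded, since a threshold exists. *)
rewrite /map /threshold; case: xgetP => // none.
by have [t /none] := threshold_exists s.
Qed.

Lemma simplex_threshold_mapping (s : 'rV[R]_C) : simplex (map s).
Proof. by split => // i; rewrite mxE. Qed.

Lemma weakly_order_preserving_threshold_mapping : weakly_order_preserving map.
Proof.
split=> [i j _ s ij|]; first by rewrite !mxE g_homo// lerB// ltW.
(* Three indices are needed: [i1] and [i2] are tied at 0, so another coordinate must carry mass. *)
pose i0 : 'I_C := Ordinal (leq_trans (isT : 0 < 3)%N C3).
pose i1 : 'I_C := Ordinal (leq_trans (isT : 1 < 3)%N C3).
pose i2 : 'I_C := Ordinal (leq_trans (isT : 2 < 3)%N C3).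
pose s : 'rV[R]_C := \row_i (if i == i0 then c + 1 else (i == i1)%:R).
exists s, i1, i2; split; rewrite // ?mxE//=.
have t_ge1 : 1 <= threshold (at_ s).
  rewrite leNgt; apply/negP => t1.
  have := sum_at_ge s (threshold (at_ s)) i0.
  rewrite -/(map s) sum_map leNgt g_gt1// mxE eqxx; lra.
by rewrite !g_le0//; lra.
Qed.

End threshold_mapping.

Theorem proposition3p5 (R : realType) (C : nat) (hC : (3 <= C)%N) :
  [/\ forall s : 'rV[R]_C, simplex (sparsemax s),
      weakly_order_preserving (@sparsemax R C) &
      ~ strictly_order_preserving (@sparsemax R C)] /\
  (forall alpha : R, 1 < alpha ->
   [/\ forall s : 'rV[R]_C, simplex (entmax alpha s),
       weakly_order_preserving (@entmax R C alpha) &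
       ~ strictly_order_preserving (@entmax R C alpha)]).
Proof.
split=> [|alpha alpha1].
- pose g (x : R) := Num.max x 0.
  have g_cont : continuous g.
    by move=> x; apply: continuous_max; [exact: cvg_id|exact: cvg_cst].
  have g_homo : {homo g : x y / x <= y} by move=> x y; exact: le_pos_part.
  have g_le0 (x : R) : x <= 0 -> g x = 0 by exact: max_r.
  have g1 : g 1 = 1 by rewrite /g max_l.
  have g_gt1 x : 1 < x -> 1 < g x by rewrite /g lt_max => ->.
  have wop : weakly_order_preserving (@sparsemax R C).
    exact: (weakly_order_preserving_threshold_mapping hC g_cont g_homo g_le0 g1).
  split=> //; last exact: weakly_order_preserving_not_strictly.
  exact: (simplex_threshold_mapping hC g_cont g_homo g_le0 g1).
- have k0 : 0 < alpha - 1 by rewrite subr_gt0.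
  have kV0 : 0 < (alpha - 1)^-1 by rewrite invr_gt0.
  pose g (x : R) := ((alpha - 1) * Num.max x 0) `^ (alpha - 1)^-1.
  have pos x : 0 <= Num.max x 0 :> R by rewrite le_max lexx orbT.
  have g_cont : continuous g.
    (* Pulling out the constant factor leaves a power of the positive part. *)
    rewrite (_ : g = fun x => (alpha - 1) `^ (alpha - 1)^-1 *
                              Num.max x 0 `^ (alpha - 1)^-1); last first.
      by apply/funext => x; rewrite /g powRM ?(ltW k0).
    move=> x; apply: cvgM; first exact: cvg_cst.
    exact: continuous_powR_pos_part.
  have g_homo : {homo g : x y / x <= y}.
    move=> x y xy; apply: ge0_ler_powR;
      rewrite ?nnegrE ?mulr_ge0 ?(ltW k0) ?(ltW kV0)//.
    by rewrite ler_pM2l// le_pos_part.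
  have g_le0 (x : R) : x <= 0 -> g x = 0.
    by move=> x0; rewrite /g max_r// mulr0 powR0// gt_eqF.
  (* The point [c] solves [(alpha - 1) * c = 1], so the base of the power is 1. *)
  have gc : g (alpha - 1)^-1 = 1.
    by rewrite /g max_l ?ltW// mulfV ?gt_eqF// powR1.
  have g_gt1 x : (alpha - 1)^-1 < x -> 1 < g x.
    move=> cx; rewrite -[X in X < _]gc; apply: gt0_ltr_powR => //.
    - by rewrite nnegrE mulr_ge0 ?(ltW k0).
    - by rewrite nnegrE mulr_ge0 ?(ltW k0).
    - by rewrite ltr_pM2l// max_l ?ltW// lt_max cx.
  have wop : weakly_order_preserving (@entmax R C alpha).
    exact: (weakly_order_preserving_threshold_mapping hC g_cont g_homo g_le0 gc).
  split=> //; last exact: weakly_order_preserving_not_strictly.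
  exact: (simplex_threshold_mapping hC g_cont g_homo g_le0 gc).
Qed.
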